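(* Let $d\ge 1$ and let $X$ be either a Euclidean building of dimension $d$, or an $\ell_\infty$-product $X=\prod_{i=1}^{d}X_i$ of $d$ geodesic, geodesically complete metric spaces $X_1,\dots,X_d$. Then any family of subsets of $X$ which coarsely separates $X$ has asymptotic dimension at least $d-1$ (the members of the family carry the metric restricted from $X$).
   Context: **Geodesically complete.** A geodesic metric space $Y$ is geodesically complete if every geodesic segment (including degenerate ones, i.e. points) extends to a bi-infinite geodesic line, i.e. to an isometric embedding $\mathbb{R}\to Y$. **Euclidean building.** A $d$-dimensional Euclidean building carries its usual metric; any two of its points lie in an apartment, i.e. in an isometrically embedded copy of Euclidean $\mathbb{R}^d$. **Coarse separation.** For $S\subseteq X$ and $L>0$, $N_L(S)$ denotes the closed $L$-neighborhood of $S$. Let $X$ be a connected metric space and $\mathcal{S}$ a family of subsets of $X$. $\mathcal{S}$ coarsely separates $X$ if there is $L>0$ such that: (1) $X\setminus N_L(S)$ has more than one path-component for all $S\in\mathcal{S}$; and (2) for all $D>0$ there exist $S\in\mathcal{S}$ and points $x,y\in X$ lying in distinct path-components of $X\setminus N_L(S)$ with $d(x,S)>D$ and $d(y,S)>D$. **Asymptotic dimension of a family.** A collection $\mathcal{W}$ of subsets of a metric space is $r$-disjoint if $d(W,W')\ge r$ for any two distinct $W,W'\in\mathcal{W}$; it is $R$-bounded if all its members have diameter at most $R$. Let $\mathcal{X}$ be a family of metric spaces. A function $D_{\mathcal{X}}:\mathbb{R}_+\to\mathbb{R}_+$ is an $n$-dimensional control function for $\mathcal{X}$ if for every $r>0$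 and every $X\in\mathcal{X}$, $X$ has a $D_{\mathcal{X}}(r)$-bounded cover $\mathcal{U}=\bigcup_{i=1}^{n+1}\mathcal{U}_i$ with each $\mathcal{U}_i$ $r$-disjoint. $\operatorname{asdim}(\mathcal{X})$ is the least integer $n$ such that $\mathcal{X}$ admits an $n$-dimensional control function ($\infty$ if there is none). *)

(* Defs.v *)
From HB Require Import structures.
From mathcomp Require Import all_boot all_order all_algebra.
From mathcomp Require Import all_classical all_reals all_analysis.

Set Implicit Arguments.
Unset Strict Implicit.
Unset Printing Implicit Defensive.

Import Order.TTheory GRing.Theory Num.Theory.
Import numFieldNormedType.Exports.

Local Open Scope classical_set_scope.
Local Open Scope ring_scope.

Section Geodesics.
Context {R : realType} (Y : metricType R).

Definition isometric_on (D : set R) (g : R -> Y) : Prop :=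
  forall s t, D s -> D t -> mdist (g s) (g t) = `|s - t|.

Definition geodesic_space : Prop :=
  forall x y : Y, exists l : R, exists g : R -> Y,
    [/\ 0 <= l, isometric_on `[0, l] g, g 0 = x & g l = y].

(* A geodesic segment is parametrized by [0, l]; l = 0 is a degenerate one.
   The values of g outside [0, l] are irrelevant. *)
Definition geodesically_complete : Prop :=
  forall (l : R) (g : R -> Y), 0 <= l -> isometric_on `[0, l] g ->
    exists c : R -> Y,
      isometric_on setT c /\ (forall t, 0 <= t <= l -> c t = g t).

End Geodesics.

(* X is identified with the product of the Xs through its coordinate map p,
   which is injective by the formula for the distance. *)
Definition is_linf_product {R : realType} (d : nat) (X : metricType R)
    (Xs : 'I_d -> metricType R) (p : X -> forall i, Xs i) : Prop :=
  (forall z : (forall i, Xs i), exists x : X, forall i, p x i = z i) /\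
  (forall x y : X,
    mdist x y = \big[Num.max/0]_(i < d) mdist (p x i) (p y i)).

Section EuclideanCoxeterComplex.
Context {R : realType} (d : nat).
Local Notation E := 'rV[R]_d.

Definition dotv (u v : E) : R := \sum_(i < d) u 0 i * v 0 i.

(* The norm that the library puts on 'rV[R]_d is the sup norm. *)
Definition eucl_dist (u v : E) : R := Num.sqrt (dotv (u - v) (u - v)).

(* For a != 0, the orthogonal reflection in the hyperplane dotv a x = c. *)
Definition affine_reflection (a : E) (c : R) (x : E) : E :=
  x - (2 * (dotv a x - c) / dotv a a) *: a.

Definition is_affine_reflection (s : E -> E) : Prop :=
  exists (a : E) (c : R), a != 0 /\ s = affine_reflection a c.

(* As reflections are involutions, the monoid that they generate is a group. *)
Inductive generated_by (M : set (E -> E)) : (E -> E) -> Prop :=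
| generated_id : generated_by M id
| generated_comp s w : M s -> generated_by M w -> generated_by M (s \o w).

Definition linear_part (w : E -> E) : E -> E := fun x => w x - w 0.

(* (E, W) is a Euclidean Coxeter complex: W is generated by reflections and
   its group of linear parts (the spherical Weyl group) is finite. W need not
   be discrete. *)
Definition affine_weyl_group (W : set (E -> E)) : Prop :=
  (exists2 M : set (E -> E), M `<=` is_affine_reflection & W = generated_by M)
  /\ finite_set (linear_part @` W).

Definition is_root (W : set (E -> E)) (a : E) : Prop :=
  a != 0 /\ (linear_part @` W) (affine_reflection a 0).

Definition regular (W : set (E -> E)) (v : E) : Prop :=
  forall a, is_root W a -> dotv a v != 0.

(* For v regular, the closed Weyl chamber of the spherical Weyl group of W
   containing v. *)
Definition weyl_chamber (W : set (E -> E)) (v : E) : set E :=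
  [set u | forall a, is_root W a -> 0 < dotv a v -> 0 <= dotv a u].

Definition sector (W : set (E -> E)) (p v : E) : set E :=
  [set p + u | u in weyl_chamber W v].

End EuclideanCoxeterComplex.

(* Tits' axioms for an atlas A of charts of a Euclidean building modelled on
   the Coxeter complex (R^d, W), for a set X that already carries the metric
   of the building. Apartments are the images of the charts. Geometric
   realizations of affine buildings are the case where W is discrete. *)
Record building_atlas {R : realType} (d : nat) (X : metricType R)
    (W : set ('rV[R]_d -> 'rV[R]_d)) (A : set ('rV[R]_d -> X)) : Prop := {
  chart_isometry : forall f, A f ->
    forall u v, mdist (f u) (f v) = eucl_dist u v;
  chart_weyl : forall f w, A f -> W w -> A (f \o w);
  chart_change : forall f g, A f -> A g ->
    [/\ closed (f @^-1` range g), convex_set (f @^-1` range g) &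
        exists2 w, W w & forall u, (f @^-1` range g) u -> f u = g (w u)];
  common_apartment : forall x y : X,
    exists2 f, A f & range f x /\ range f y;
  common_sectors : forall f g p v q v', A f -> A g ->
    regular W v -> regular W v' ->
    exists p' q' h,
      [/\ sector W p' v `<=` sector W p v, sector W q' v' `<=` sector W q v',
          A h, f @` sector W p' v `<=` range h &
          g @` sector W q' v' `<=` range h];
  apartment_retraction : forall f u, A f -> exists rho : X -> X,
    [/\ forall x, range f (rho x),
        forall x, range f x -> rho x = x,
        forall x y, mdist (rho x) (rho y) <= mdist x y &
        forall x, rho x = f u -> x = f u]
}.

Definition euclidean_building {R : realType} (d : nat) (X : metricType R) :=
  exists (W : set ('rV[R]_d -> 'rV[R]_d)) (A : set ('rV[R]_d -> X)),
    affine_weyl_group W /\ building_atlas W A.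

Section CoarseSeparation.
Context {R : realType} (X : metricType R).

(* Here and below, the distance to the empty set is +oo. *)
Definition closed_neighborhood (L : R) (S : set X) : set X :=
  [set x | (edist_inf S x <= L%:E)%E].

Definition path_component (B : set X) (x : X) : set X :=
  [set y | exists g : R -> X,
    [/\ {within `[0, 1], continuous g}, g 0 = x, g 1 = y &
        forall t, 0 <= t <= 1 -> B (g t)]].

Definition in_distinct_path_components (B : set X) (x y : X) : Prop :=
  [/\ B x, B y & ~ path_component B x y].

Definition coarsely_separates (F : set (set X)) : Prop :=
  exists L : R, [/\ 0 < L,
    forall S, F S -> exists x y,
      in_distinct_path_components (~` closed_neighborhood L S) x y &
    forall D : R, 0 < D -> exists S x y,
      [/\ F S,
          in_distinct_path_components (~` closed_neighborhood L S) x y,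
          (D%:E < edist_inf S x)%E & (D%:E < edist_inf S y)%E]].

End CoarseSeparation.

Section AsymptoticDimension.
Context {R : realType} (X : metricType R).

Definition r_disjoint (r : R) (U : set (set X)) : Prop :=
  forall V V', U V -> U V' -> V <> V' ->
    forall x y, V x -> V' y -> r <= mdist x y.

Definition r_bounded (r : R) (U : set (set X)) : Prop :=
  forall V, U V -> forall x y, V x -> V y -> mdist x y <= r.

(* The members of F are regarded as metric spaces for the restricted metric,
   so their covers consist of subsets of them: S equals the union. *)
Definition control_function (n : nat) (F : set (set X)) (D : R -> R) : Prop :=
  (forall r, 0 <= r -> 0 <= D r) /\
  forall r, 0 < r -> forall S, F S -> exists U : 'I_n.+1 -> set (set X),
    [/\ S = \bigcup_(i in setT) \bigcup_(V in U i) V,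
        forall i, r_bounded (D r) (U i) & forall i, r_disjoint r (U i)].

Definition asdim (F : set (set X)) : \bar R :=
  ereal_inf [set n%:R%:E | n in
    [set n | exists D : R -> R, control_function n F D]].

End AsymptoticDimension.

(* Main.v *)
Require Import Defs.
From HB Require Import structures.
From mathcomp Require Import all_boot all_order all_algebra.
From mathcomp Require Import ring lra zify.
From mathcomp Require Import all_classical all_reals all_analysis.

Set Implicit Arguments.
Unset Strict Implicit.
Unset Printing Implicit Defensive.

Import Order.TTheory GRing.Theory Num.Theory.
Import numFieldNormedType.Exports.

Local Open Scope classical_set_scope.
Local Open Scope ring_scope.

(* Any two points of X lie in a bi-Lipschitz copy of (R^d, sup norm): an
   apartment, resp. a product of d geodesic lines. Suppose that S has a cover by
   d - 1 families, each r-disjoint and bounded, and that x and y are far from S.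
   In the flat through x and y, take a large box around the segment [x, y] and
   give each of the d - 1 directions transverse to the segment its own family.
   The pieces of that family which come near the lower face in this direction
   stay away from the upper face, so they define a set A_k separating the two
   faces; in the direction of [x, y], let A_j be the path component of x in the
   complement of the neighbourhood of S. If y were not in A_j, a discrete
   Poincare-Miranda theorem on a fine grid would give a small cube that meets
   every A_k and its complement. By r-disjointness, no piece of a family is near
   this cube, so the cube avoids the neighbourhood of S and lies on one side of
   A_j, a contradiction.

   The Poincare-Miranda theorem is proved by counting mod 2: the cup product of
   the coboundaries of the indicator functions of the A_k is itself a coboundary,
   and its sum over the grid telescopes to the boundary, where it equals 1. *)

(** * Mod 2 cup products on the cubical grid *)

Section CupProduct.
Variable T : eqType.
Implicit Types (i j k : T) (v p q : T -> nat) (s : seq T).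

Definition shift i v : T -> nat := fun j => (v j + (j == i))%N.

Definition set_coord i (n : nat) v : T -> nat :=
  fun j => if j == i then n else v j.

Definition unit_cube v : set (T -> nat) :=
  [set p | forall i, (v i <= p i <= (v i).+1)%N].

(* The value at the cube with lowest vertex v and edge directions s of the cup
   product over F_2 of the coboundaries of the functions in fs. *)
Fixpoint cup (fs : seq ((T -> nat) -> 'F_2)) s v : 'F_2 :=
  if fs is f :: fs' then
    \sum_(i <- s) (f (shift i v) - f v) * cup fs' (rem i s) (shift i v)
  else 1.

Lemma shiftC i j v : shift i (shift j v) = shift j (shift i v).
Proof. by apply/funext => k; rewrite /shift addnAC. Qed.

Lemma F2_addrr (x : 'F_2) : x + x = 0.
Proof. by apply: addrr_pchar2; rewrite pchar_Fp. Qed.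

Lemma F2_oppr (x : 'F_2) : - x = x.
Proof. by apply/eqP; rewrite eq_sym -addr_eq0 F2_addrr. Qed.

Lemma remC i j s : uniq s -> rem i (rem j s) = rem j (rem i s).
Proof.
move=> us; rewrite !rem_filter ?filter_uniq // -!filter_predI.
by apply: eq_filter => k; rewrite /= andbC.
Qed.

Lemma exchange_rem (h : T -> T -> 'F_2) s : uniq s ->
  \sum_(i <- s) \sum_(j <- rem i s) h i j =
  \sum_(j <- s) \sum_(i <- rem j s) h i j.
Proof.
move=> us.
under eq_bigr do rewrite rem_filter // big_filter.
under [RHS]eq_bigr do rewrite rem_filter // big_filter.
rewrite (exchange_big_dep predT) //=.
by apply: eq_bigr => j _; apply: eq_bigl => i; rewrite /= eq_sym.
Qed.

(** Every unordered pair of distinct entries is counted twice. *)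
Lemma sum_symmetric_F2 (h : T -> T -> 'F_2) s :
  uniq s -> (forall i j, h i j = h j i) ->
  \sum_(i <- s) \sum_(j <- rem i s) h i j = 0.
Proof.
move=> + hC; elim: s => [|k s IH]; first by rewrite big_nil.
move=> /=/andP[ks us]; rewrite big_cons /= eqxx.
have -> : \sum_(i <- s) \sum_(j <- rem i (k :: s)) h i j =
          \sum_(i <- s) (h i k + \sum_(j <- rem i s) h i j).
  apply: eq_big_seq => i si; have ki : k != i by apply: contraNneq ks => ->.
  by rewrite /= (negbTE ki) big_cons.
rewrite big_split IH //= addr0.
by under eq_bigr do rewrite hC; exact: F2_addrr.
Qed.

(** A cup product of coboundaries is a cocycle. By the Leibniz rule its coboundary splits into
    second differences of [f], symmetric in the two directions and so cancelling mod 2, and terms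
    with the coboundary of [cup fs], zero by induction. *)
Lemma cup_closed fs s v : uniq s ->
  \sum_(i <- s) (cup fs (rem i s) (shift i v) - cup fs (rem i s) v) = 0.
Proof.
elim: fs s v => [|f fs IH] s v us /=.
  by rewrite big1 // => i _; rewrite subrr.
pose D i v := f (shift i v) - f v.
transitivity (\sum_(i <- s) \sum_(j <- rem i s)
   (D j (shift i v) - D j v) * cup fs (rem j (rem i s)) (shift j (shift i v))
 + \sum_(i <- s) \sum_(j <- rem i s)
    D j v * (cup fs (rem j (rem i s)) (shift i (shift j v))
             - cup fs (rem j (rem i s)) (shift j v))).
  rewrite -big_split; apply: eq_bigr => i _.
  rewrite -sumrB -big_split; apply: eq_bigr => j _ /=.
  by rewrite /D -(shiftC j i); ring.
rewrite sum_symmetric_F2 //; last first.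
  by move=> i j; rewrite /D (shiftC j i) remC //; ring.
rewrite add0r.
transitivity (\sum_(j <- s) \sum_(i <- rem j s)
    D j v * (cup fs (rem i (rem j s)) (shift i (shift j v))
             - cup fs (rem i (rem j s)) (shift j v))).
  rewrite exchange_rem //; apply: eq_bigr => j _; apply: eq_bigr => i _.
  by rewrite remC.
rewrite big1_seq // => j /= sj.
by rewrite -big_distrr /= IH ?mulr0 ?rem_uniq.
Qed.

(** This is the coboundary of [f] times [cup fs]: the other term of the Leibniz rule, [f v] times
    the coboundary of [cup fs], vanishes by [cup_closed]. *)
Lemma cup_cons f fs s v : uniq s ->
  cup (f :: fs) s v =
  \sum_(i <- s) (f (shift i v) * cup fs (rem i s) (shift i v)
                 - f v * cup fs (rem i s) v).
Proof.
move=> us; have H := cup_closed fs v us.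
transitivity (cup (f :: fs) s v + f v *
    \sum_(i <- s) (cup fs (rem i s) (shift i v) - cup fs (rem i s) v)).
  by rewrite H mulr0 addr0.
by rewrite big_distrr -big_split; apply: eq_bigr => i _ /=;
  rewrite mulrBl mulrBr addrA subrK.
Qed.

Lemma unit_cube_refl v : unit_cube v v.
Proof. by move=> i; rewrite leqnn leqnSn. Qed.

Lemma unit_cube_shift i v : unit_cube v (shift i v).
Proof. by move=> j; rewrite /shift; case: (j == i); lia. Qed.

Definition subcube s v : set (T -> nat) :=
  [set p | unit_cube v p /\ forall i, i \notin s -> p i = v i].

Lemma subcube_shift s i v p : uniq s -> i \in s ->
  subcube (rem i s) (shift i v) p -> subcube s v p.
Proof.
move=> us si [pc pe]; split => [j|j sj].
  have := pc j; have [->|ji] := eqVneq j i; last by rewrite /shift (negbTE ji) addn0.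
  by rewrite pe ?mem_rem_uniqF // /shift eqxx; lia.
rewrite pe; first by
  rewrite /shift; case: eqP sj si => [-> /negbTE->|]; rewrite ?addn0.
by rewrite mem_rem_uniq // inE negb_and (negbTE sj) orbT.
Qed.

(** All edges visited by the recursion lie in the face [subcube s v], where the coboundary of [f] is
    zero. *)
Lemma cup_const (f : (T -> nat) -> 'F_2) (fs : seq ((T -> nat) -> 'F_2)) s v :
  f \in fs -> uniq s ->
  (forall p q, subcube s v p -> subcube s v q -> f p = f q) ->
  cup fs s v = 0.
Proof.
elim: fs s v => // g fs IH s v + us fc /=.
rewrite inE => /orP[/eqP <-|ffs]; apply: big1_seq => i /= si.
  rewrite (fc _ v) ?subrr ?mul0r //; split=> //.
  - exact: unit_cube_shift.
  - move=> j sj; rewrite /shift.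
    by case: eqP sj si => [-> /negbTE->|]; rewrite ?addn0.
  - exact: unit_cube_refl.
rewrite (IH (rem i s)) ?mulr0 ?rem_uniq // => p q pc qc.
by apply: fc; apply: (subcube_shift us si).
Qed.

Variable N : nat.

(** Points stand for the unit cubes of which they are the lowest vertex, hence [n < N] for a box of
    side [N]. *)
Fixpoint box_sum s (g : (T -> nat) -> 'F_2) v : 'F_2 :=
  if s is i :: s' then \sum_(n < N) box_sum s' g (set_coord i n v) else g v.

Lemma set_coordC i j m n v : i != j ->
  set_coord i m (set_coord j n v) = set_coord j n (set_coord i m v).
Proof.
move=> ij; apply/funext => k; rewrite /set_coord.
by have [->|//] := eqVneq k i; rewrite (negbTE ij).
Qed.

Lemma eq_box_sum s g h v :
  (forall p, (forall i, i \notin s -> p i = v i) -> g p = h p) ->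
  box_sum s g v = box_sum s h v.
Proof.
elim: s v => [|i s IH] v gh /=; first exact: gh.
apply: eq_bigr => n _; apply: IH => p pv; apply: gh => j.
rewrite inE negb_or => /andP[ji js]; rewrite pv //.
by rewrite /set_coord (negbTE ji).
Qed.

Lemma box_sumB s g h v :
  box_sum s (fun p => g p - h p) v = box_sum s g v - box_sum s h v.
Proof.
by elim: s v => //= i s IH v; under eq_bigr do rewrite IH; exact: sumrB.
Qed.

Lemma box_sum_sum (r : seq T) (g : T -> (T -> nat) -> 'F_2) s v :
  box_sum s (fun p => \sum_(i <- r) g i p) v = \sum_(i <- r) box_sum s (g i) v.
Proof.
elim: s v => //= i s IH v; under eq_bigr do rewrite IH.
by rewrite exchange_big.
Qed.

Lemma box_sum0 s v : box_sum s (fun=> 0) v = 0.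
Proof. by elim: s v => //= i s IH v; rewrite big1. Qed.

Lemma box_sum_rem i s g v : uniq s -> i \in s ->
  box_sum s g v = box_sum (i :: rem i s) g v.
Proof.
elim: s v => // j s IH v /= /andP[js us]; rewrite inE.
have [-> //|ij /= si] := eqVneq i j.
under eq_bigr do rewrite (IH _ us si).
rewrite exchange_big; apply: eq_bigr => n _; apply: eq_bigr => m _.
by rewrite (set_coordC _ _ _ ij).
Qed.

Lemma box_sum_shift i s g n v : i \notin s ->
  box_sum s (fun p => g (shift i p)) (set_coord i n v) =
  box_sum s g (set_coord i n.+1 v).
Proof.
elim: s v => [|j s IH] v /=.
  move=> _; congr g; apply/funext => k; rewrite /shift /set_coord.
  by case: eqP => //; rewrite ?addn1 ?addn0.
rewrite inE negb_or => /andP[ij si]; apply: eq_bigr => m _.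
by rewrite -(set_coordC _ _ _ ij) IH // set_coordC.
Qed.

Lemma box_sum_telescope i s g v : uniq s -> i \in s ->
  box_sum s (fun p => g (shift i p) - g p) v =
  box_sum (rem i s) g (set_coord i N v) - box_sum (rem i s) g (set_coord i 0 v).
Proof.
move=> us si; rewrite (box_sum_rem _ _ us si) /=.
rewrite -(telescope_sumr (fun n => box_sum (rem i s) g (set_coord i n v))) //.
rewrite big_mkord; apply: eq_bigr => n _; rewrite box_sumB box_sum_shift //.
by rewrite mem_rem_uniqF.
Qed.

(** By [cup_cons] the sum telescopes to the boundary. On the faces across [i] in [s], [f i] is
    constant, which kills the cup product. Across [k], the upper face has [f k = 0]; the lower one
    has [f k = 1] and leaves the same sum in one dimension less. *)
Lemma box_sum_cup (f : T -> (T -> nat) -> 'F_2) s v : uniq s ->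
  (forall i p, p i = 0%N -> f i p = 1) -> (forall i p, p i = N -> f i p = 0) ->
  box_sum s (cup (map f s) s) v = 1.
Proof.
move=> + f0 fN; elim: s v => // k s IH v us.
have {IH}IH := IH _ (proj2 (andP us)).
have face i w b : i \in s -> (b == 0%N) || (b == N) -> w i = b ->
    cup (map f s) (rem i (k :: s)) w = 0.
  move=> si bE wi; apply: (@cup_const (f i)); rewrite ?map_f ?rem_uniq //.
  move=> p q [_ pw] [_ qw]; move: (pw i) (qw i).
  rewrite mem_rem_uniqF // wi => /(_ isT) pb /(_ isT) qb.
  case/orP: bE => /eqP bE; first by rewrite !f0 // ?pb ?qb.
  by rewrite !fN // ?pb ?qb.
pose g i p := f k p * cup (map f s) (rem i (k :: s)) p.
rewrite map_cons (eq_box_sum (h := fun p =>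
    \sum_(i <- k :: s) (g i (shift i p) - g i p))); last first.
  by move=> p _; exact: cup_cons.
rewrite box_sum_sum big_cons.
rewrite [X in _ + X]big1_seq ?addr0; last first.
  move=> i /= si; have ki : i \in k :: s by rewrite inE si orbT.
  rewrite [LHS](box_sum_telescope (g i) v us ki).
  have z b : (b == 0%N) || (b == N) ->
      box_sum (rem i (k :: s)) (g i) (set_coord i b v) = 0.
    move=> bE; rewrite (eq_box_sum (h := fun=> 0)) ?box_sum0 // => p pv.
    rewrite /g (face i p b) ?mulr0 //.
    by rewrite pv ?mem_rem_uniqF // /set_coord eqxx.
  by rewrite !z ?eqxx ?orbT // subrr.
rewrite [LHS](box_sum_telescope (g k) v us (mem_head k s)) /g /= eqxx.
have ks : k \notin s by case/andP: us.
rewrite (eq_box_sum (h := fun=> 0)) ?box_sum0 => [|p pv]; last first.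
  by rewrite fN ?mul0r // pv // /set_coord eqxx.
rewrite sub0r F2_oppr -[RHS](IH (set_coord k 0%N v)).
apply: eq_box_sum => p pv; rewrite f0 ?mul1r //.
by rewrite pv // /set_coord eqxx.
Qed.

End CupProduct.

(** Otherwise some indicator function is constant on each cube, so all the cup products are 0 and
    cannot sum to 1. *)
Lemma grid_miranda (I : finType) (N : nat) (A : I -> set (I -> nat)) :
  (forall i p, p i = 0%N -> A i p) -> (forall i p, p i = N -> ~ A i p) ->
  exists v, forall i, exists p q,
    [/\ unit_cube v p, unit_cube v q, A i p & ~ A i q].
Proof.
move=> A0 AN; pose f i p : 'F_2 := (`[< A i p >])%:R.
have f0 i p : p i = 0%N -> f i p = 1 by move=> /A0; rewrite /f => /asboolT ->.
have fN i p : p i = N -> f i p = 0 by move=> /AN; rewrite /f => /asboolF ->.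
have := box_sum_cup (fun=> 0%N) (enum_uniq I) f0 fN.
apply: contra_eqP => /forallNP H.
rewrite (@eq_box_sum _ _ _ _ (fun=> 0)) ?box_sum0 1?eq_sym ?oner_eq0 // => p _.
have /existsNP[i iH] := H p.
apply: (@cup_const _ (f i)); rewrite ?enum_uniq ?map_f ?mem_enum //.
move=> x y [px _] [py _]; rewrite /f.
suff -> : A i x = A i y by [].
apply/propext; split=> Ai; apply: contrapT => nA; apply: iH.
  by exists x, y.
by exists y, x.
Qed.

(** * Paths and closed neighbourhoods *)

Section Paths.
Context {R : realType} {X : metricType R}.
Implicit Types (B S : set X) (x y z : X).

Lemma lipschitz_continuous (g : R -> X) (K : R) :
  (forall s t, mdist (g s) (g t) <= K * `|s - t|) -> continuous g.
Proof.
move=> gK t; apply/cvg_ballP => e e0.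
have K0 : 0 < `|K| + 1 by rewrite ltr_wpDl.
near=> s; rewrite ballEmdist /=; apply: le_lt_trans (gK _ _) _.
apply: (@le_lt_trans _ _ ((`|K| + 1) * `|t - s|)).
  by rewrite ler_wpM2r // (le_trans (ler_norm K)) // lerDl.
rewrite mulrC -ltr_pdivlMr //.
near: s; apply: (@cvgr_dist_lt _ _ _ (nbhs t) _ id t) => //.
exact: divr_gt0.
Unshelve. all: end_near. Qed.

Lemma path_component_lipschitz B (g : R -> X) (K : R) :
  (forall s t, mdist (g s) (g t) <= K * `|s - t|) ->
  (forall t, 0 <= t <= 1 -> B (g t)) -> path_component B (g 0) (g 1).
Proof.
move=> gK gB; exists g; split=> //.
exact/continuous_subspaceT/(lipschitz_continuous gK).
Qed.

Lemma within_continuous_reparam (I J : set R) (m : R -> R) (g : R -> X) :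
  continuous m -> (forall t, I t -> J (m t)) ->
  {within J, continuous g} -> {within I, continuous (g \o m)}.
Proof.
move=> mc IJ /subspace_continuousP gc; apply/subspace_continuousP => t It.
move=> U /(gc _ (IJ _ It)) JU.
have : \forall s \near t, J (m s) -> U (g (m s)) by exact: (mc t _ JU).
by apply: (@filterS _ (nbhs t)) => s /= + /IJ; apply.
Qed.

Lemma path_component_trans B x y z :
  path_component B x y -> path_component B y z -> path_component B x z.
Proof.
move=> [g [gc g0 g1 gB]] [h [hc h0 h1 hB]].
pose k t := if t <= 2^-1 then g (2 * t) else h (2 * t - 1).
(* Both branches give [y] at 1/2, so continuity can be glued along two closed intervals. *)
have k_h t : 2^-1 <= t -> k t = h (2 * t - 1).
  rewrite /k le_eqVlt => /orP[/eqP <-|tgt]; last by rewrite leNgt tgt.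
  by rewrite lexx divff ?pnatr_eq0 // g1 subrr h0.
have c2 : continuous (fun t : R => 2 * t) by move=> t; exact: mulrl_continuous.
exists k; split.
- have -> : `[0, 1]%classic = `[0, 2^-1]%classic `|` `[2^-1, (1 : R)]%classic.
    apply/seteqP; split=> t /=; rewrite !in_itv /=.
      by have [] := leP t 2^-1; [left|right]; lra.
    by case; lra.
  apply: withinU_continuous; try exact: interval_closed.
  + apply: (@subspace_eq_continuous _ _ _ (g \o (fun t => 2 * t))).
      move=> t; rewrite inE /= in_itv /= => /andP[_ tle].
      by change (g (2 * t) = k t); rewrite /k tle.
    apply: within_continuous_reparam gc => // t /=; rewrite !in_itv /=; lra.
  + apply: (@subspace_eq_continuous _ _ _ (h \o (fun t => 2 * t - 1))).
      move=> t; rewrite inE /= in_itv /= => /andP[tge _].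
      by change (h (2 * t - 1) = k t); rewrite k_h.
    apply: within_continuous_reparam hc => [|t /=]; last by rewrite !in_itv /=; lra.
    by move=> t; apply: cvgB; [exact: c2|exact: cvg_cst].
- by rewrite /k invr_ge0 ler0n mulr0.
- by rewrite k_h ?invf_le1 ?ltr0n ?ler1n // mulr1 -[2]natr1 addrK.
- move=> t t01; have [tle|tgt] := leP t 2^-1.
    by rewrite /k tle; apply: gB; lra.
  by rewrite k_h ?ltW //; apply: hB; lra.
Qed.

Lemma path_component_sym B x y : path_component B x y -> path_component B y x.
Proof.
move=> [g [gc g0 g1 gB]]; exists (g \o (fun t => 1 - t)); split => /=.
- apply: within_continuous_reparam gc => [|t /=]; last by rewrite !in_itv /=; lra.
  by move=> t; apply: cvgB; [exact: cvg_cst|exact: cvg_id].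
- by rewrite subr0.
- by rewrite subrr.
- by move=> t t01; apply: gB; lra.
Qed.

Lemma le_mdist_of_lt_edist_inf S x (D : R) s :
  S s -> (D%:E < edist_inf S x)%E -> D <= mdist x s.
Proof.
move=> Ss; apply: contraTle => xs; rewrite -leNgt.
have D0 : 0 < D by apply: le_lt_trans xs; exact: mdist_ge0.
apply: le_trans (edist_fin (xy := (x, s)) D0 _); last by rewrite ballEmdist.
by apply: ereal_inf_lbound; exists s.
Qed.

(** The margin [e] is uniform in [s]: distances that all exceed [L] may still have infimum [L]. *)
Lemma notin_closed_neighborhood S (L e : R) x : 0 < e ->
  (forall s, S s -> L + e <= mdist x s) -> (~` closed_neighborhood L S) x.
Proof.
move=> e0 far; rewrite /closed_neighborhood /= => near.
have : (edist_inf S x < (L + e)%:E)%E.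
  by rewrite (le_lt_trans near) // lte_fin ltrDl.
move=> /ereal_inf_lt[_ [s Ss <-]] /edist_lt_ball; rewrite ballEmdist /=.
by rewrite ltNge far.
Qed.

End Paths.

(** * Flats through two points *)

Section Flats.
Context {R : realType} (d : nat) {X : metricType R}.

(** A bi-Lipschitz embedding for the sup norm, which is spelled out in coordinates. *)
Definition flat_chart (C : R) (f : 'rV[R]_d -> X) : Prop :=
  (forall (u v : 'rV[R]_d) k, `|u 0 k - v 0 k| <= mdist (f u) (f v)) /\
  (forall (u v : 'rV[R]_d) (e : R), 0 <= e -> (forall k, `|u 0 k - v 0 k| <= e) ->
    mdist (f u) (f v) <= C * e).

(** In a common apartment, the Euclidean norm lies between the sup norm and [d] times it; [d] is a
    crude bound for its square root. *)
Lemma building_flat : euclidean_building d X -> forall x y : X,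
  exists f u v, [/\ flat_chart d%:R f, f u = x & f v = y].
Proof.
move=> [W [A [_ HA]]] x y.
have [f Af [[u _ <-] [v _ <-]]] := common_apartment HA x y.
exists f, u, v; split=> //; split => [a b k|a b e e0 ab].
  rewrite (chart_isometry HA) // /eucl_dist -sqrtr_sqr ler_wsqrtr //.
  rewrite /dotv (bigD1 k) //= !mxE -expr2 lerDl.
  by apply: sumr_ge0 => i _; rewrite -expr2 sqr_ge0.
rewrite (chart_isometry HA) // /eucl_dist.
rewrite -[leRHS]ger0_norm ?mulr_ge0 ?ler0n // -sqrtr_sqr ler_wsqrtr //.
apply: (@le_trans _ _ (\sum_(i < d) e ^+ 2)).
  apply: ler_sum => i _; rewrite !mxE -expr2 -real_normK ?num_real //.
  by rewrite ler_sqr ?nnegrE.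
rewrite sumr_const card_ord exprMn -[leLHS]mulr_natl ler_wpM2r ?sqr_ge0 //.
by rewrite -natrX ler_nat; nia.
Qed.

(** In each factor, a geodesic between the two coordinates (degenerate if they agree) extends to a
    line; the product of these lines is isometric to the sup norm. *)
Lemma product_flat (Xs : 'I_d -> metricType R) (p : X -> forall i, Xs i) :
  is_linf_product p -> (forall i, geodesic_space (Xs i)) ->
  (forall i, geodesically_complete (Xs i)) -> (0 < d)%N -> forall x y : X,
  exists f u v, [/\ flat_chart d%:R f, f u = x & f v = y].
Proof.
move=> [psurj pdist] geo comp d0 x y.
have line i : exists lc : R * (R -> Xs i),
    [/\ isometric_on setT lc.2, lc.2 0 = p x i & lc.2 lc.1 = p y i].
  have [l [g [l0 gi g0 gl]]] := geo i (p x i) (p y i).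
  have [c [ci cg]] := comp i l g l0 gi.
  by exists (l, c); rewrite /= !cg ?lexx ?l0.
pose lc i := projT1 (cid (line i)).
have lcP i := projT2 (cid (line i)).
pose f (u : 'rV[R]_d) := projT1 (cid (psurj (fun i => (lc i).2 (u 0 i)))).
have fE u i : p (f u) i = (lc i).2 (u 0 i).
  exact: (projT2 (cid (psurj (fun i => (lc i).2 (u 0 i))))).
have pinj a b : (forall i, p a i = p b i) -> a = b.
  move=> ab; apply: mdist_positivity; apply/eqP; rewrite eq_le mdist_ge0 andbT.
  by rewrite pdist; apply/bigmax_leP; split=> // i _; rewrite ab mdistxx.
have fdist u v : mdist (f u) (f v) = \big[Num.max/0]_(i < d) `|u 0 i - v 0 i|.
  rewrite pdist; apply: eq_bigr => i _; rewrite !fE.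
  by have [ci _ _] := lcP i; rewrite ci.
exists f, 0, (\row_i (lc i).1); split.
- split=> [a b k|a b e e0 ab]; rewrite fdist.
    exact: (le_bigmax_cond _ (fun k => `|a 0 k - b 0 k|)).
  apply: (@le_trans _ _ e); last by rewrite ler_peMl // ler1n.
  by apply/bigmax_leP.
- by apply: pinj => i; rewrite fE mxE; have [] := lcP i.
- by apply: pinj => i; rewrite fE mxE; have [] := lcP i.
Qed.

(** The image of the segment stays within [C * e] of [f a], so at distance at least [L + 1] from
    [S]. *)
Lemma path_component_segment (f : 'rV[R]_d -> X) (C L e : R) (S : set X)
    (a b : 'rV[R]_d) :
  flat_chart C f -> 0 <= e -> 0 <= C ->
  (forall k, `|a 0 k - b 0 k| <= e) ->
  (forall s, S s -> C * e + L + 1 <= mdist (f a) s) ->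
  path_component (~` closed_neighborhood L S) (f a) (f b).
Proof.
move=> [_ fC] e0 C0 ab far.
pose g t := f (a + t *: (b - a)).
have gL s t : mdist (g s) (g t) <= C * (e * `|s - t|).
  apply: fC => [|k]; first exact: mulr_ge0.
  rewrite !mxE (_ : _ - _ = (b 0 k - a 0 k) * (s - t)); last by ring.
  by rewrite normrM distrC ler_wpM2r.
have -> : f a = g 0 by rewrite /g scale0r addr0.
have -> : f b = g 1 by rewrite /g scale1r addrC subrK.
apply: (@path_component_lipschitz _ _ _ _ (C * e)) => [s t|t /andP[t0 t1]].
  by rewrite -mulrA.
apply: (@notin_closed_neighborhood _ _ _ _ 1) => // s /far.
have := metric_triangle (f a) (g t) s.
have : mdist (f a) (g t) <= C * e.
  have -> : f a = g 0 by rewrite /g scale0r addr0.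
  apply: le_trans (gL _ _) _; rewrite sub0r normrN ger0_norm //.
  by rewrite mulrA ler_piMr // mulr_ge0.
by lra.
Qed.

End Flats.

(** * A sheared box around a segment *)

Section Box.
Context {R : realType} (d N : nat) (j : 'I_d) (u w : 'rV[R]_d) (M : R).

(** [grid_miranda] quantifies over grid points with unbounded coordinates; clamping keeps their
    images in the box. *)
Definition clamped_ratio (n : nat) : R := (minn n N)%:R / N%:R.

Local Notation ratio := clamped_ratio.

(* The box spanned by the segment [u, w], used in direction j, and by the
   segments of length 2 M in the other coordinate directions. *)
Definition box_point (p : 'I_d -> nat) : 'rV[R]_d :=
  \row_k (u 0 k + ratio (p j) * (w 0 k - u 0 k) +
          if k == j then 0 else 2 * M * ratio (p k) - M).

Lemma clamped_ratio0 : ratio 0 = 0.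
Proof. by rewrite /ratio min0n mul0r. Qed.

Lemma clamped_ratioN : (0 < N)%N -> ratio N = 1.
Proof. by move=> N0; rewrite /ratio minnn divff // pnatr_eq0 -lt0n. Qed.

Lemma clamped_ratio_itv n : (0 < N)%N -> 0 <= ratio n <= 1.
Proof.
move=> N0;
rewrite /ratio divr_ge0 ?ler0n //= ler_pdivrMr ?ltr0n // mul1r ler_nat.
exact: geq_minr.
Qed.

Lemma clamped_ratio_dist (n n' : nat) :
  (0 < N)%N -> (n <= n'.+1)%N -> (n' <= n.+1)%N ->
  `|ratio n - ratio n'| <= N%:R^-1.
Proof.
move=> N0 nn' n'n; rewrite /ratio -mulrBl normrM.
rewrite [X in _ * X]ger0_norm ?invr_ge0 ?ler0n //.
rewrite ler_piMl ?invr_ge0 ?ler0n // ler_norml.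
rewrite -[_ - _ <= 1]subr_ge0 -[-1 <= _]subr_ge0.
have h1 : (minn n N <= (minn n' N).+1)%N by lia.
have h2 : (minn n' N <= (minn n N).+1)%N by lia.
by move: h1 h2; rewrite -!(ler_nat R) -!natr1; lra.
Qed.

Lemma box_point_bottom p k : (0 < N)%N -> 0 <= M ->
  p j = 0%N -> `|u 0 k - box_point p 0 k| <= M.
Proof.
move=> N0 M0 pj; rewrite mxE pj clamped_ratio0 mul0r addr0 ler_norml.
case: eqP => _; first by lra.
have /andP[t0 t1] := clamped_ratio_itv (p k) N0.
have := mulr_ge0 M0 t0; rewrite -subr_ge0 in t1; have := mulr_ge0 M0 t1.
lra.
Qed.

Lemma box_point_top p k : (0 < N)%N -> 0 <= M ->
  p j = N -> `|w 0 k - box_point p 0 k| <= M.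
Proof.
move=> N0 M0 pj; rewrite mxE pj (clamped_ratioN N0) mul1r ler_norml.
case: eqP => _; first by lra.
have /andP[t0 t1] := clamped_ratio_itv (p k) N0.
have := mulr_ge0 M0 t0; rewrite -subr_ge0 in t1; have := mulr_ge0 M0 t1.
lra.
Qed.

(** The shear along [w - u] may bring the [k]-th coordinates closer than the width [2 * M]. If it
    leaves less than [M], it moves coordinate [k] by more than [M], hence also coordinate [j], where
    [w - u] is largest. *)
Lemma box_point_sides p q k : (0 < N)%N ->
  (forall i, `|w 0 i - u 0 i| <= `|w 0 j - u 0 j|) ->
  k != j -> p k = 0%N -> q k = N ->
  exists i, M <= `|box_point p 0 i - box_point q 0 i|.
Proof.
move=> N0 jmax kj pk qk; have [|small] := leP M `|box_point p 0 k - box_point q 0 k|.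
  by exists k.
exists j; move: small; rewrite !mxE (negbTE kj) eqxx pk qk.
rewrite clamped_ratio0 (clamped_ratioN N0).
set t := ratio (p j); set t' := ratio (q j) => small.
rewrite (_ : _ - _ = (t - t') * (w 0 j - u 0 j)); last by ring.
rewrite normrM; apply: le_trans (ler_wpM2l (normr_ge0 _) (jmax k)).
rewrite -normrM; move: small; rewrite ltr_norml => /andP[small _].
rewrite ler_normr; apply/orP; left; lra.
Qed.

Lemma box_point_adjacent (K : R) v p q k : (0 < N)%N -> 0 <= M ->
  (forall i, `|w 0 i - u 0 i| <= K) ->
  unit_cube v p -> unit_cube v q ->
  `|box_point p 0 k - box_point q 0 k| <= (K + 2 * M) / N%:R.
Proof.
move=> N0 M0 wK vp vq; rewrite !mxE.
have close i : `|ratio (p i) - ratio (q i)| <= N%:R^-1.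
  by apply: (clamped_ratio_dist N0); have := vp i; have := vq i; lia.
set a := ratio (p j) * _; set b := ratio (q j) * _.
have ab : `|a - b| <= K / N%:R.
  by rewrite /a /b -mulrBl normrM mulrC ler_pM.
have MN : 0 <= 2 * M / N%:R by rewrite !mulr_ge0 // invr_ge0 ler0n.
rewrite [leRHS]mulrDl; case: eqP => _.
  rewrite (_ : _ - _ = a - b); last by ring.
  by rewrite (le_trans ab) // lerDl.
rewrite (_ : _ - _ = (a - b) + 2 * M * (ratio (p k) - ratio (q k))); last by ring.
rewrite (le_trans (ler_normD _ _)) // lerD // normrM ger0_norm ?mulr_ge0 //.
by rewrite ler_wpM2l ?mulr_ge0.
Qed.

End Box.

(** * Sets with too few colours do not separate points of a flat *)

Section FlatSeparation.
Context {R : realType} (m : nat) {X : metricType R}.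

Lemma coloured_set_not_separating (C L r rho M : R) (S : set X)
    (U : 'I_m -> set (set X)) (f : 'rV[R]_m.+1 -> X) (u w : 'rV[R]_m.+1) :
  flat_chart C f -> 0 <= C -> 0 <= L -> 0 <= rho ->
  S = \bigcup_(i in setT) \bigcup_(V in U i) V ->
  (forall i, r_bounded rho (U i)) -> (forall i, r_disjoint r (U i)) ->
  2 * (L + 3) < r -> 2 * (L + 3) + rho < M ->
  (forall s, S s -> C * M + L + 1 <= mdist (f u) s) ->
  (forall s, S s -> C * M + L + 1 <= mdist (f w) s) ->
  path_component (~` closed_neighborhood L S) (f u) (f w).
Proof.
move=> fC C0 L0 rho0 SE bounded disjoint Lr LM farx fary.
have [f_ge f_le] := fC.
have M0 : 0 <= M by lra.
have [j jmax] : exists j, forall i, `|w 0 i - u 0 i| <= `|w 0 j - u 0 j|.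
  exists [arg max_(i > ord0) `|w 0 i - u 0 i|]%O.
  by case: Order.TotalTheory.arg_maxP => // i _ imax k; apply: imax.
pose K : R := `|w 0 j - u 0 j|.
(* The mesh is so fine that vertices of one cube have images at distance at most 1. *)
have [N N0 KN] : exists2 N : nat, (0 < N)%N & C * (K + 2 * M) <= N%:R.
  exists (Num.truncn (C * (K + 2 * M))).+1 => //.
  by rewrite ltW // truncnS_gt.
pose Q p := f (box_point N j u w M p).
have K0 : 0 <= K by exact: normr_ge0.
have e0 : 0 <= (K + 2 * M) / N%:R by rewrite divr_ge0 ?ler0n ?addr_ge0 ?mulr_ge0.
have Ce : C * ((K + 2 * M) / N%:R) <= 1.
  by rewrite mulrA ler_pdivrMr ?ltr0n // mul1r.
have adj v p q : unit_cube v p -> unit_cube v q -> mdist (Q p) (Q q) <= 1.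
  move=> vp vq; apply: le_trans Ce; apply: f_le => // k.
  exact: (box_point_adjacent j k N0 M0 jmax vp vq).
pose near p e (V : set X) := exists2 s, V s & mdist (Q p) s <= L + e.
pose low (i : 'I_m) V := exists2 q : 'I_m.+1 -> nat, q (lift j i) = 0%N & near q 3 V.
(* Colour [i] governs the direction [lift j i]. The clause [p k = 0] includes the whole lower face,
   also where no piece is near. *)
pose A k p := if unlift j k is Some i
  then p k = 0%N \/ exists V, [/\ U i V, low i V & near p 3 V]
  else path_component (~` closed_neighborhood L S) (f u) (Q p).
apply: contrapT => nconn.
have [k p pk|k p pk|v vP] := @grid_miranda _ N A.
- rewrite /A; case: unliftP => [i _|kj]; first by left.
  apply: (path_component_segment fC M0 C0) => // i.
  by apply: box_point_bottom => //; rewrite -kj.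
- rewrite /A; case: unliftP => [i ki|kj].
    (* A piece near both faces would put them at distance at most [2 * (L + 3) + rho], which is less
       than [M]. *)
    case=> [pk0|[V [UV [q qk [s Vs qs]] [s' Vs' ps']]]].
      by move: N0; rewrite -pk pk0.
    have kj : lift j i != j by rewrite eq_sym neq_lift.
    rewrite ki in pk.
    have [k' Mk'] := box_point_sides M N0 jmax kj qk pk.
    have := f_ge (box_point N j u w M q) (box_point N j u w M p) k'.
    have := metric_triangle (Q q) s (Q p).
    have := metric_triangle s s' (Q p).
    have := bounded i V UV s s' Vs Vs'.
    move: (metric_sym (Q p) s') ps' qs Mk'; rewrite /Q; lra.
  move=> xp; apply: nconn; apply: path_component_trans xp _.
  have QP : path_component (~` closed_neighborhood L S) (f w) (Q p).
    apply: (path_component_segment fC M0 C0) => // i.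
    by apply: box_point_top => //; rewrite -kj.
  exact: path_component_sym.
(* A piece [V] within [L + 2] of one vertex is within [L + 3] of all. As [b] is outside the set, [V]
   is not low; as [a] is inside, a low piece [V'] of the same colour is within [L + 3] of [a]. Then
   [V] and [V'] are closer than [r]. *)
- have clear p s : unit_cube v p -> S s -> L + 2 <= mdist (Q p) s.
    move=> vp; rewrite SE => -[i _ [V UV Vs]]; rewrite leNgt; apply/negP => ps.
    have [a [b [va vb]]] := vP (lift j i).
    rewrite /A liftK => Aa Ab.
    have nearV c : unit_cube v c -> near c 3 V.
      move=> vc; exists s => //; have := metric_triangle (Q c) (Q p) s.
      have := adj v c p vc vp; lra.
    have nlow : ~ low i V.
      by move=> lowV; apply: Ab; right; exists V; split=> //; exact: nearV.
    case: Aa => [a0|[V' [UV' lowV' [s' Vs' as']]]].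
      by apply: nlow; exists a => //; exact: nearV.
    have VV' : V <> V' by move=> VV'; apply: nlow; rewrite VV'.
    have := disjoint i V V' UV UV' VV' s s' Vs Vs'.
    have := metric_triangle s (Q a) s'; rewrite (metric_sym s (Q a)).
    have := metric_triangle (Q a) (Q p) s; have := adj v a p va vp.
    lra.
  have [a [b [va vb]]] := vP j; rewrite /A unlift_none => xa; apply.
  apply: path_component_trans xa _.
  (* The segment from [a] to [b] uses up at most 1 of the clearance [L + 2]. *)
  apply: (path_component_segment fC e0 C0) => [i|s Ss].
    exact: (box_point_adjacent j i N0 M0 jmax va vb).
  by have := clear a s va Ss; move: Ce; rewrite /Q; lra.
Qed.

End FlatSeparation.

(** * The bound on asymptotic dimension *)

Theorem corollary1p3 (R : realType) (d : nat) (hd : (1 <= d)%N)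
    (X : metricType R)
    (hX : euclidean_building d X \/
          (exists (Xs : 'I_d -> metricType R) (p : X -> forall i, Xs i),
             [/\ is_linf_product p,
                 forall i, geodesic_space (Xs i) &
                 forall i, geodesically_complete (Xs i)]))
    (F : set (set X)) (hF : coarsely_separates F) :
  (d.-1%:R%:E <= asdim F)%E.
Proof.
apply: le_ereal_inf_tmp => _ [n [D [D0 cover]] <-].
rewrite lee_fin ler_nat leqNgt; apply/negP => nd.
case: d hd hX nd => // m _ {}hX /= nm.
have flat (x y : X) : exists (f : 'rV[R]_m.+1 -> X) u w,
    [/\ flat_chart m.+1%:R f, f u = x & f w = y].
  case: hX => [/building_flat|[Xs [p [pX geo comp]]]]; first exact.
  exact: product_flat pX _ _ _ _ _.
have [L [L0 _ far]] := hF.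
pose r := 2 * (L + 3) + 1; pose M := 2 * (L + 3) + D r + 1.
have r0 : 0 < r by rewrite /r; lra.
have Dr0 : 0 <= D r by apply: D0; exact: ltW.
(* This is how far from [S] the two points are chosen, with [m.+1] the Lipschitz constant of the
   flats. *)
have D'0 : 0 < m.+1%:R * M + L + 1.
  have : 0 <= m.+1%:R * M by rewrite mulr_ge0 // /M; lra.
  by lra.
have [S [x [y [FS [_ _ sep] xS yS]]]] := far _ D'0.
have [U [SU Ubounded Udisjoint]] := cover _ r0 _ FS.
have [f [u [w [fC fu fw]]]] := flat x y; subst x y.
(* The [n.+1 <= m] families are padded with empty ones to exactly [m], one for each transverse
   direction. *)
pose U' (i : 'I_m) V := exists2 k : 'I_n.+1, k = i :> nat & U k V.
apply: sep.
apply: (coloured_set_not_separating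
  (r := r) (rho := D r) (M := M) (U := U') fC) => //.
- exact: ltW.
- rewrite SU; apply/seteqP; split=> [s [k _ [V UV Vs]]|s [i _ [V [k _ UV] Vs]]].
    by exists (widen_ord nm k) => //; exists V => //; exists k.
  by exists k => //; exists V.
- by move=> i V [k _ UV]; exact: Ubounded UV.
- move=> i V V' [k ki UV] [k' k'i UV'].
  have kk' : k = k' by apply: val_inj; rewrite /= ki k'i.
  by rewrite -kk' in UV'; exact: Udisjoint UV UV'.
- by rewrite /r; lra.
- by rewrite /M; lra.
- by move=> s Ss; exact: le_mdist_of_lt_edist_inf xS.
- by move=> s Ss; exact: le_mdist_of_lt_edist_inf yS.
Qed.
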